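(* Let $k\ge 2$ and let $\mathcal{P}_k$ be a set of patterns such that for every ordered matching $M$, $\mathrm{mn}(M)\le k$ if and only if $M$ contains no pattern from $\mathcal{P}_k$. Then $\mathcal{P}_k$ is infinite.
   Context: An ordered graph is a graph $G$ with a total order $\prec$ on $V(G)$; an ordered matching is an ordered graph of maximum degree at most one. Two edges $uv$, $xy$ ($u\prec v$, $x\prec y$, four distinct endpoints) cross if $u\prec x\prec v\prec y$ or $x\prec u\prec y\prec v$, and nest if $u\prec x\prec y\prec v$ or $x\prec u\prec v\prec y$. A stack is an edge set with no two crossing edges, a queue one with no two nesting edges. $\mathrm{mn}(G)$ is the minimum $s+q$ such that the edges of $G$ can be partitioned into $s$ stacks and $q$ queues with respect to the given order. A pattern is an ordered graph with at least one edge; an ordered graph contains a pattern $H$ if it has a subgraph isomorphic to $H$ via an order-preserving isomorphism, and avoids it otherwise. *)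

(* Defs.v *)
From HB Require Import structures.
From mathcomp Require Import all_boot all_order.

Set Implicit Arguments.
Unset Strict Implicit.
Unset Printing Implicit Defensive.

Import Order.TTheory.

(* Graphs are finite and simple. *)
Record ograph := OGraph {
  disp : Order.disp_t;
  vertex : finOrderType disp;
  adj : rel vertex;
  adj_sym : symmetric adj;
  adj_irr : irreflexive adj }.

(* Each edge is listed once, as the pair of its endpoints in increasing
   order. *)
Definition edge (G : ograph) : finType :=
  {e : vertex G * vertex G | (e.1 < e.2)%O && adj e.1 e.2}.

Section StacksQueues.
Variable G : ograph.
Implicit Types (e f : edge G) (A : {set edge G}).

Definition cross e f : bool :=
  let: (u, v) := val e in let: (x, y) := val f in
  [&& u < x, x < v & v < y]%O || [&& x < u, u < y & y < v]%O.

Definition nest e f : bool :=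
  let: (u, v) := val e in let: (x, y) := val f in
  [&& u < x, x < y & y < v]%O || [&& x < u, u < v & v < y]%O.

Definition stack A : bool := [forall e in A, forall f in A, ~~ cross e f].
Definition queue A : bool := [forall e in A, forall f in A, ~~ nest e f].

(* A partition of the edges into s stacks and q queues (some possibly empty) is
   given by the function sending each edge to its part. *)
Definition stack_queue_partition (s q : nat) : bool :=
  [exists c : {ffun edge G -> 'I_s + 'I_q},
    [forall i : 'I_s, stack [set e | c e == inl i]] &&
    [forall j : 'I_q, queue [set e | c e == inr j]]].

Definition mixed_layout (n : nat) : bool :=
  [exists s : 'I_n.+1, stack_queue_partition s (n - s)].

Lemma mixed_layout_ex : exists n, mixed_layout n.
Proof.
exists #|edge G|; apply/existsP; exists ord_max => /=.
apply/existsP; exists [ffun e => inl (enum_rank e)].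
apply/andP; split; apply/forallP => i; last first.
  by apply/forall_inP => e; rewrite inE ffunE.
apply/forall_inP => e; rewrite inE ffunE => /eqP [eE].
apply/forall_inP => f; rewrite inE ffunE => /eqP [fE].
have -> : f = e by apply: enum_rank_inj; rewrite fE eE.
by rewrite /cross; case: (val e) => u v; rewrite ltxx.
Qed.

Definition mn : nat := ex_minn mixed_layout_ex.

End StacksQueues.

Definition ordered_matching (G : ograph) : Prop :=
  forall x : vertex G, #|[set y | adj x y]| <= 1.

Definition pattern (H : ograph) : Prop := exists x y : vertex H, adj x y.

(* f is an order-preserving isomorphism from H onto the subgraph of G with
   vertices f(V(H)) and edges f(E(H)); this subgraph need not be induced. *)
Definition contains (G H : ograph) : Prop :=
  exists f : vertex H -> vertex G,
    {mono f : x y / (x < y)%O} /\ {homo f : x y / adj x y}.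

Definition isomorphic (G H : ograph) : Prop :=
  exists f : vertex G -> vertex H,
    [/\ bijective f, {mono f : x y / (x < y)%O} & {mono f : x y / adj x y}].

(* Patterns are counted up to isomorphism: isomorphic copies on different
   vertex types are not distinct members, and no finite family represents
   every member of P. In particular, P is infinite as a collection of
   ordered graphs. *)
Definition infinitely_many (P : ograph -> Prop) : Prop :=
  ~ exists (n : nat) (F : 'I_n -> ograph),
      forall H : ograph, P H -> exists i : 'I_n, isomorphic H (F i).

(* Main.v *)
Require Import Defs.
From mathcomp Require Import all_boot all_order.
From HB Require Import structures.
From mathcomp Require Import zify.

(* Write k = q + 2.  Take q nested twists (sets of pairwise crossing edges) of
   size k + 1, inside them an odd cycle of the crossing relation, and beside all
   this two rainbows (sets of pairwise nesting edges) of size k + 1 crossing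
   each other.  A layout with s stacks and r queues, s + r <= k, puts some edge
   of each rainbow in a stack, so s >= 2; it puts some edge of each twist in a
   queue, so r >= q, hence s = 2 and r = q, all queues meet the twists, and the
   odd cycle is left with two stacks, which is impossible.  After deleting one
   edge of the cycle, two stacks and q queues suffice.  A subgraph with fewer
   vertices than the cycle has edges misses such an edge, so the sizes of the
   patterns are unbounded. *)

Set Implicit Arguments.
Unset Strict Implicit.
Unset Printing Implicit Defensive.

(* [width] may exceed all endpoints: unused positions are isolated vertices, so
   that deleting a chord does not change the vertex set. *)
Record chords := Chords {
  chord : finType;
  lft : chord -> nat;
  rgt : chord -> nat;
  width : nat;
  lft_rgt : forall x, lft x < rgt x;
  rgt_width : forall x, rgt x < width;
  lft_inj : injective lft;
  rgt_inj : injective rgt;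
  lft_neq_rgt : forall x y, lft x != rgt y }.

Lemma pigeonhole_lt t m (h : 'I_t -> nat) :
  (forall i, h i < m) -> m < t -> exists i j : 'I_t, i < j /\ h i = h j.
Proof.
move=> hm mt; pose g i : 'I_m := Ordinal (hm i).
have /injectivePn[i [j ij]] : ~~ injectiveb g.
  by apply/negP => /injectiveP/leq_card; rewrite !card_ord leqNgt mt.
move/(congr1 val) => /= E; case: (ltngtP i j) => [lt|lt|/val_inj ij'].
- by exists i, j.
- by exists j, i.
- by rewrite ij' eqxx in ij.
Qed.

(** * Matchings given by chords, and their layouts *)

Section ChordGraph.
Variable D : chords.
Implicit Types x y : chord D.

Lemma lft_width x : lft x < width D.
Proof. exact: ltn_trans (lft_rgt x) (rgt_width x). Qed.

Definition lpt x : 'I_(width D) := Ordinal (lft_width x).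
Definition rpt x : 'I_(width D) := Ordinal (rgt_width x).

Definition chord_adj : rel 'I_(width D) := fun u v =>
  [exists x, ((u, v) == (lpt x, rpt x)) || ((v, u) == (lpt x, rpt x))].

Lemma chord_adj_sym : symmetric chord_adj.
Proof. by move=> u v; apply: eq_existsb => x; rewrite orbC. Qed.

Lemma chord_adj_irr : irreflexive chord_adj.
Proof.
move=> u; apply/existsP => -[x]; rewrite orbb => /eqP[-> /(congr1 val)/= E].
by have := lft_rgt x; rewrite E ltnn.
Qed.

Definition chord_graph : ograph := OGraph chord_adj_sym chord_adj_irr.

Lemma chord_graph_matching : ordered_matching chord_graph.
Proof.
move=> u; apply/card_le1_eqP => v w; rewrite !inE /= => /existsP[x Hx] /existsP[y Hy].
case/orP: Hx => /eqP[]; case/orP: Hy => /eqP[].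
- by move=> -> -> /(congr1 val)/lft_inj -> ->.
- move=> -> -> /(congr1 val)/= E; have := lft_neq_rgt x y.
  by rewrite E eqxx.
- move=> -> -> -> /(congr1 val)/= E; have := lft_neq_rgt y x.
  by rewrite E eqxx.
- by move=> -> -> -> /(congr1 val)/rgt_inj ->.
Qed.

(** One-sided forms: [x] starts first, respectively is the outer chord. Since [layout] ranges over
    ordered pairs, both orientations are excluded. *)
Definition crossing x y := lft x < lft y < rgt x /\ rgt x < rgt y.
Definition nesting x y := lft x < lft y /\ rgt y < rgt x.

(* Colours below [s] are stacks, those from [s] to [s + q - 1] are queues. *)
Definition layout (s q : nat) (c : chord D -> nat) : Prop :=
  [/\ forall x, c x < s + q,
      forall x y, c x = c y -> c x < s -> ~ crossing x y
    & forall x y, c x = c y -> s <= c x -> ~ nesting x y].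

Lemma lpt_lt_rpt x :
  ((lpt x, rpt x).1 < (lpt x, rpt x).2)%O && chord_adj (lpt x) (rpt x).
Proof.
by rewrite Order.OrdinalOrder.ltEord /= lft_rgt; apply/existsP; exists x; rewrite eqxx.
Qed.

Definition chord_edge x : edge chord_graph := Sub (lpt x, rpt x) (lpt_lt_rpt x).

Lemma edge_chord (e : edge chord_graph) : exists x, e == chord_edge x.
Proof.
case/andP: (valP e) => uv /existsP[x] /orP[] /eqP.
  by case=> ux vx; exists x; rewrite -val_eqE /= -ux -vx -surjective_pairing.
case=> vx ux; move: uv; rewrite ux vx Order.OrdinalOrder.ltEord /=.
by move=> /ltn_trans/(_ (lft_rgt x)); rewrite ltnn.
Qed.

Lemma stack_queue_partitionP s q :
  reflect (exists c, layout s q c) (stack_queue_partition chord_graph s q).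
Proof.
apply: (iffP existsP) => [[c /andP[/forallP cs /forallP cq]]|[c [cb cs cq]]].
  exists (fun x => unsplit (c (chord_edge x))); split=> [x|x y|x y]; first exact: ltn_ord.
  - move=> /val_inj/(can_inj unsplitK) E; case Ec: (c _) => [i|i] /=; last by lia.
    move=> _ [? ?].
    move/forall_inP/(_ (chord_edge x)): (cs i); rewrite inE Ec eqxx => /(_ isT).
    move/forall_inP/(_ (chord_edge y)); rewrite inE -E Ec eqxx => /(_ isT).
    rewrite /cross /= !Order.OrdinalOrder.ltEord /=; lia.
  - move=> /val_inj/(can_inj unsplitK) E; case Ec: (c _) => [i|i] /=.
      by have := ltn_ord i; lia.
    move=> _ [? ?].
    move/forall_inP/(_ (chord_edge x)): (cq i); rewrite inE Ec eqxx => /(_ isT).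
    move/forall_inP/(_ (chord_edge y)); rewrite inE -E Ec eqxx => /(_ isT).
    have := lft_rgt y.
    rewrite /nest /= !Order.OrdinalOrder.ltEord /=; lia.
have [ch chK] : {ch & cancel ch chord_edge}.
  exists (fun e => xchoose (edge_chord e)) => e.
  by apply/esym/eqP; exact: (xchooseP (edge_chord e)).
exists [ffun e => split (Ordinal (cb (ch e)))].
apply/andP; split; apply/forallP => i.
  have ci e : split (Ordinal (cb (ch e))) == inl i -> c (ch e) = i.
    by move=> /eqP/(congr1 (@unsplit _ _)); rewrite splitK => /(congr1 val).
  apply/forall_inP => e; rewrite inE ffunE => /ci ei.
  apply/forall_inP => f; rewrite inE ffunE => /ci fi.
  have il := ltn_ord i; rewrite -(chK e) -(chK f).
  have := cs (ch e) (ch f); have := cs (ch f) (ch e); rewrite ei fi.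
  move=> /(_ erefl il) H1 /(_ erefl il) H2.
  rewrite /cross /= !Order.OrdinalOrder.ltEord /=.
  by apply/negP => /orP[] H; [apply: H2 | apply: H1]; rewrite /crossing; lia.
have ci e : split (Ordinal (cb (ch e))) == inr i -> c (ch e) = s + i.
  by move=> /eqP/(congr1 (@unsplit _ _)); rewrite splitK => /(congr1 val).
apply/forall_inP => e; rewrite inE ffunE => /ci ei.
apply/forall_inP => f; rewrite inE ffunE => /ci fi.
rewrite -(chK e) -(chK f).
have il := leq_addr i s.
have := cq (ch e) (ch f); have := cq (ch f) (ch e); rewrite ei fi.
move=> /(_ erefl il) H1 /(_ erefl il) H2.
rewrite /nest /= !Order.OrdinalOrder.ltEord /=.
by apply/negP => /orP[] H; [apply: H2 | apply: H1]; rewrite /nesting; lia.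
Qed.

Lemma mn_chord_graph_le k :
  reflect (exists s q c, s + q <= k /\ layout s q c) (mn chord_graph <= k).
Proof.
rewrite /mn; case: ex_minnP => n Hn nmin.
apply: (iffP idP) => [nk|[s [q [c [le_k Hc]]]]].
  case/existsP: Hn => s /stack_queue_partitionP[c Hc].
  by exists s, (n - s), c; split=> //; have := ltn_ord s; lia.
apply: leq_trans le_k; apply: nmin; apply/existsP.
have s_lt : s < (s + q).+1 by lia.
by exists (Ordinal s_lt); rewrite /= addKn; apply/stack_queue_partitionP; exists c.
Qed.

(** * Rainbows and twists in a layout *)

Section Homogeneous.
Variables (s q : nat) (c : chord D -> nat).
Hypothesis cL : layout s q c.

(** By pigeonhole two chords share a colour; they nest, so that colour is not a queue. *)
Lemma rainbow_has_stack t (h : 'I_t -> chord D) :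
  (forall i j : 'I_t, i < j -> nesting (h i) (h j)) -> s + q < t ->
  exists i, c (h i) < s.
Proof.
case: cL => cb _ cq hN /(@pigeonhole_lt t _ (c \o h) (fun i => cb _)) [i [j [ij E]]].
exists i; rewrite ltnNge; apply/negP => /(cq _ _ E); apply; exact: hN.
Qed.

Lemma twist_has_queue t (h : 'I_t -> chord D) :
  (forall i j : 'I_t, i < j -> crossing (h i) (h j)) -> s + q < t ->
  exists i, s <= c (h i).
Proof.
case: cL => cb cs _ hC /(@pigeonhole_lt t _ (c \o h) (fun i => cb _)) [i [j [ij E]]].
exists i; rewrite leqNgt; apply/negP => /(cs _ _ E); apply; exact: hC.
Qed.

(** Nesting chords lie in different queues, and shifting colours by [s] leaves only [q] values. *)
Lemma queues_of_rainbow t (h : 'I_t -> chord D) :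
  (forall i j : 'I_t, i < j -> nesting (h i) (h j)) -> (forall i, s <= c (h i)) -> t <= q.
Proof.
case: cL => cb _ cq hN hs; rewrite leqNgt; apply/negP => qt.
have [|i [j [ij E]]] := @pigeonhole_lt t q (fun i => c (h i) - s) _ qt.
  by move=> i; have := cb (h i); have := hs i; lia.
apply: (cq (h i) (h j)); [|exact: hs|exact: hN].
by have := hs i; have := hs j; lia.
Qed.

End Homogeneous.
End ChordGraph.

Section SubChords.
Variables (D : chords) (z : chord D).

Definition del_chord : chords :=
  @Chords {x : chord D | x != z} (@lft D \o val) (@rgt D \o val) (width D)
    (fun x => lft_rgt (val x)) (fun x => rgt_width (val x))
    (inj_comp (@lft_inj D) val_inj) (inj_comp (@rgt_inj D) val_inj)
    (fun x y => lft_neq_rgt (val x) (val y)).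

End SubChords.

(** * The obstruction and its critical chords *)

Section Obstruction.
Variables q m : nat.

(** [Path] chords cross each other exactly when consecutive, and [Closing] crosses only the first
    and last of them: a cycle of odd length 2m + 3. *)
Inductive obs_chord : predArgType :=
  | Path of 'I_(2 * m).+2
  | Closing
  | Twist of 'I_q & 'I_q.+3
  | Rainbow of bool & 'I_q.+3.

Definition obs_code x : 'I_(2 * m).+2 + unit + 'I_q * 'I_q.+3 + bool * 'I_q.+3 :=
  match x with
  | Path i => inl (inl (inl i))
  | Closing => inl (inl (inr tt))
  | Twist i j => inl (inr (i, j))
  | Rainbow b j => inr (b, j)
  end.

Definition obs_decode y : obs_chord :=
  match y with
  | inl (inl (inl i)) => Path i
  | inl (inl (inr tt)) => Closing
  | inl (inr (i, j)) => Twist i j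
  | inr (b, j) => Rainbow b j
  end.

Lemma obs_codeK : cancel obs_code obs_decode. Proof. by case. Qed.

HB.instance Definition _ := Finite.copy obs_chord (can_type obs_codeK).

(* From left to right: left ends of the twists (outermost first), the cycle from
   [c0] on, right ends of the twists (innermost first, the outermost one starting
   at [w0]), and the rainbows from [z0] on. *)
Let t := q.+3.
Let c0 := q * t.
Let w0 := 2 * c0 + 4 * m + 6.
Let z0 := w0 + t.

Definition obs_lft (x : obs_chord) : nat :=
  match x with
  | Path i => c0 + 2 * i
  | Closing => c0 + 1
  | Twist i j => i * t + j
  | Rainbow b j => z0 + b * t + j
  end.

(** Subtracting [i * t] makes outer twists end later; the [2 * c0] in [w0] keeps these ends beyond
    the cycle, which stops at [c0 + 4 * m + 5]. The rainbows use four successive ranges: left ends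
    of both, then right ends of both, so they cross completely. *)
Definition obs_rgt (x : obs_chord) : nat :=
  match x with
  | Path i => c0 + 2 * i + 3
  | Closing => c0 + 4 * m + 4
  | Twist i j => w0 - i * t + j
  | Rainbow b j => z0 + b * t + 3 * t - j
  end.

Lemma block_le i j : i < j -> i * t + t <= j * t.
Proof. by move=> ij; rewrite -mulSnr leq_mul2r ij orbT. Qed.

Lemma twist_block (i : 'I_q) : i * t + t <= c0.
Proof. exact: block_le. Qed.

(** The product [i * t] is nonlinear, so its bound [twist_block] is supplied by hand. *)
Ltac obs_lia :=
  rewrite /crossing /nesting /=;
  repeat match goal with
  | i : 'I_q |- _ => move: (twist_block i) (ltn_ord i); move: (nat_of_ord i) => {}i
  | i : 'I__ |- _ => move: (ltn_ord i); move: (nat_of_ord i) => {}i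
  | b : bool |- _ => case: b
  end; rewrite /= /z0 /w0 -/t; lia.

Lemma obs_lft_rgt x : obs_lft x < obs_rgt x.
Proof. by case: x => [i||i j|b j] /=; obs_lia. Qed.

Lemma obs_rgt_width x : obs_rgt x < z0 + 4 * t + 1.
Proof. by case: x => [i||i j|b j] /=; obs_lia. Qed.

Lemma twist_pos (j : 'I_q.+3) : j < t.
Proof. exact: ltn_ord. Qed.

Lemma twist_eq (i i' : 'I_q) (j j' : 'I_q.+3) :
  i * t + j = i' * t + j' -> Twist i j = Twist i' j'.
Proof.
have := twist_pos j; have := twist_pos j'.
case: (ltngtP i i') => [/block_le|/block_le|/ord_inj ->]; [lia|lia|].
by move=> _ _ E; congr Twist; apply: ord_inj; lia.
Qed.

Lemma obs_lft_inj : injective obs_lft.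
Proof.
case=> [i||i j|b j] [i'||i' j'|b' j'] //=; try by move=> E; exfalso; move: E; obs_lia.
- by move=> E; congr Path; apply: ord_inj; lia.
- exact: twist_eq.
- move=> E; have bb : b = b' by move: E; obs_lia.
  by subst b'; congr Rainbow; apply: ord_inj; lia.
Qed.

Lemma obs_rgt_inj : injective obs_rgt.
Proof.
case=> [i||i j|b j] [i'||i' j'|b' j'] //=; try by move=> E; exfalso; move: E; obs_lia.
- by move=> E; congr Path; apply: ord_inj; lia.
- move=> E; case: (ltngtP i i') => [/block_le|/block_le|/ord_inj ii'].
  + by move=> ii'; exfalso; move: E ii'; obs_lia.
  + by move=> ii'; exfalso; move: E ii'; obs_lia.
  + by subst i'; congr Twist; apply: ord_inj; lia.
- move=> E; have bb : b = b' by move: E; obs_lia.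
  subst b'; congr Rainbow; apply: ord_inj; move: E.
  have := twist_pos j; have := twist_pos j'; lia.
Qed.

Lemma obs_lft_neq_rgt x y : obs_lft x != obs_rgt y.
Proof. by case: x => [i||i j|b j]; case: y => [i'||i' j'|b' j'] /=; obs_lia. Qed.

Definition obstruction : chords :=
  Chords obs_lft_rgt obs_rgt_width obs_lft_inj obs_rgt_inj obs_lft_neq_rgt.

(* Along the path the two stacks alternate, except across the deleted chord. *)
Definition obs_colour (z : 'I_(2 * m).+2) (x : obs_chord) : nat :=
  match x with
  | Path i => odd i (+) (z < i)
  | Closing => 1
  | Twist i _ => i.+2
  | Rainbow b _ => b
  end.

(** The flip at [z] gives each surviving end of the path colour 0, leaving colour 1 for [Closing].
    Each twist is a queue of its own, and the rainbows, disjoint from the cycle, take one stack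
    each. *)
Lemma del_obstruction_layout z :
  layout 2 q (fun x : chord (@del_chord obstruction (Path z)) => obs_colour z (val x)).
Proof.
have path_neq (i : 'I_(2 * m).+2) : Path i != Path z -> i != z :> nat.
  by apply: contraNneq => /ord_inj ->.
split=> [x|[x xz] [y yz]|[x xz] [y yz]]; rewrite /crossing /nesting /=.
- by case: (val x) => [i||i j|b j] /=; obs_lia.
- case: x xz => [i||i j|b j] xz; case: y yz => [i'||i' j'|b' j'] yz;
    try move: (path_neq _ xz); try move: (path_neq _ yz); clear xz yz path_neq;
    by obs_lia.
- case: x xz => [i||i j|b j] xz; case: y yz => [i'||i' j'|b' j'] yz;
    clear xz yz path_neq; by obs_lia.
Qed.

(** * The full obstruction has no layout with k parts *)

Notation crosses x y := (@crossing obstruction x y).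
Notation nests x y := (@nesting obstruction x y).

Lemma nests_rainbow b (i j : 'I_t) : i < j -> nests (Rainbow b i) (Rainbow b j).
Proof. obs_lia. Qed.

Lemma crosses_rainbow (i j : 'I_t) : crosses (Rainbow false i) (Rainbow true j).
Proof. obs_lia. Qed.

Lemma crosses_twist i (j j' : 'I_t) : j < j' -> crosses (Twist i j) (Twist i j').
Proof. obs_lia. Qed.

Lemma nests_twist (i i' : 'I_q) (j j' : 'I_t) :
  i < i' -> nests (Twist i j) (Twist i' j').
Proof. by move=> /block_le; obs_lia. Qed.

Lemma nests_twist_path i (j : 'I_t) i' : nests (Twist i j) (Path i').
Proof. obs_lia. Qed.

Lemma nests_twist_closing i (j : 'I_t) : nests (Twist i j) Closing.
Proof. obs_lia. Qed.

Lemma crosses_path (i j : 'I_(2 * m).+2) : j = i.+1 :> nat -> crosses (Path i) (Path j).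
Proof. obs_lia. Qed.

Lemma crosses_path_closing : crosses (Path ord0) Closing.
Proof. obs_lia. Qed.

Lemma crosses_closing_path : crosses Closing (Path ord_max).
Proof. obs_lia. Qed.

Lemma obstruction_no_layout s r c : s + r <= q.+2 -> ~ @layout obstruction s r c.
Proof.
move=> sr cL; have sr_lt : s + r < t by [].
case: (cL) => cb cs cq.
have rainbow b : exists j, c (Rainbow b j) < s.
  by apply: (rainbow_has_stack cL _ sr_lt) => i j; exact: nests_rainbow.
have [s_le1 | s_gt1] := leqP s 1.
  have [[j cj] [j' cj']] := (rainbow false, rainbow true).
  by apply: (cs _ _ _ cj (crosses_rainbow j j')); lia.
have /fin_all_exists[h hs] (i : 'I_q) : exists j, s <= c (Twist i j).
  by apply: (twist_has_queue cL _ sr_lt) => j j'; exact: crosses_twist.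
(* One chord from each twist, outermost twist first, gives a rainbow lying in the queues. *)
have qr : q <= r.
  apply: (queues_of_rainbow cL (h := fun i => Twist i (h i))) => // i j.
  exact: nests_twist.
have s2 : s = 2 by lia.
have inner x : (forall i, nests (Twist i (h i)) x) -> c x < 2.
  move=> xT; rewrite ltnNge; apply/negP => cx.
  pose g (i : 'I_q.+1) := if unlift ord_max i is Some j then Twist j (h j) else x.
  (* If [x] were in a queue, then placed innermost, at [ord_max], it would extend the chosen twist
     chords to a rainbow of q + 1 queue chords. *)
  suff : q < r by lia.
  apply: (queues_of_rainbow cL (h := g)) => [i j ij|i]; rewrite /g.
    case: unliftP => [i' Ei|Ei]; last by move: ij (ltn_ord j); rewrite Ei /=; lia.
    case: unliftP => [j' Ej|//]; apply: nests_twist.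
    by move: ij; rewrite Ei Ej !lift_max.
  by case: unlift => [j|]; rewrite ?s2 // -s2.
have cP i : c (Path i) < 2 by apply: inner => j; exact: nests_twist_path.
have cC : c Closing < 2 by apply: inner => j; exact: nests_twist_closing.
have proper x y : crosses x y -> c x < 2 -> c x <> c y.
  by rewrite -s2 => xy cx E; exact: cs E cx xy.
have alternate n (ltn : n < (2 * m).+2) :
    c (Path (Ordinal ltn)) = odd n (+) odd (c (Path ord0)) :> nat.
  elim: n ltn => [|n IHn] ltn.
    by rewrite (_ : Ordinal ltn = ord0); [have := cP ord0; lia | exact: val_inj].
  have := IHn (ltnW ltn); have := cP (Ordinal ltn).
  have PP : crosses (Path (Ordinal (ltnW ltn))) (Path (Ordinal ltn)).
    exact: crosses_path.
  by have := proper _ _ PP (cP _); lia.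
(* The last index 2m + 1 is odd, so the ends of the path use both stacks, yet [Closing] crosses both
   ends. *)
have := alternate _ (ltn_ord ord_max).
rewrite (_ : Ordinal _ = ord_max); last exact: val_inj.
have := proper _ _ crosses_path_closing (cP _).
have := proper _ _ crosses_closing_path cC.
by have := cP ord0; rewrite /=; lia.
Qed.

End Obstruction.

(** * Small patterns miss a path chord *)

Lemma del_chord_contains (D : chords) (z : chord D) (H : ograph)
    (f : vertex H -> 'I_(width D)) :
  {mono f : x y / (x < y)%O} -> {homo f : x y / adj x y >-> chord_adj x y} ->
  (forall x, f x != lpt z) -> contains (chord_graph (del_chord z)) H.
Proof.
move=> f_lt f_adj fz; exists f; split=> // x y /f_adj /existsP[u Hu].
(* The chord of an image edge is not [z], because [f] misses the left end of [z]. *)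
have uz : u != z by apply: contraTneq Hu => ->; rewrite !xpair_eqE !(negPf (fz _)).
apply/existsP; exists (Sub u uz : chord (del_chord z)).
by move: Hu; rewrite !xpair_eqE -!val_eqE.
Qed.

Theorem theorem4 (k : nat) (P : ograph -> Prop)
    (hk : 2 <= k)
    (hpattern : forall H : ograph, P H -> pattern H)
    (hP : forall M : ograph, ordered_matching M ->
      (mn M <= k <-> ~ exists H : ograph, P H /\ contains M H)) :
  infinitely_many P.
Proof.
case=> n [F PF]; pose m := \max_(i < n) #|vertex (F i)|.
case: k hk hP => [|[|q]] // _ hP.
pose M := obstruction q m; pose path z : chord M := Path q z.
have [_ M_avoid] := hP _ (@chord_graph_matching M).
have : ~ mn (chord_graph M) <= q.+2.
  by move=> /mn_chord_graph_le[s [r [c [le_k]]]]; exact: obstruction_no_layout.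
apply; apply: M_avoid => -[H [PH [f [f_lt f_adj]]]].
have H_small : #|vertex H| <= m.
  have [i [g [/bij_eq_card -> _ _]]] := PF H PH.
  exact: (leq_bigmax i).
(* The 2m + 2 path chords have distinct left ends, too many to be all hit by at most m vertices. *)
have [z /forallP fz] : exists z : 'I_(2 * m).+2, [forall x, f x != lpt (path z)].
  apply/existsP; apply: contraT => /existsPn fz.
  have {}fz z : exists x, f x == lpt (path z).
    by case/forallPn: (fz z) => x; rewrite negbK; exists x.
  have [g gP] := fin_all_exists fz.
  have g_inj : injective g.
    move=> z z' E; have := eqP (gP z); rewrite E (eqP (gP z')) => /(congr1 val)/=.
    by move=> zz'; apply: val_inj => /=; lia.
  have := leq_trans (leq_card g g_inj) H_small; rewrite card_ord.
  by move: (m) => p; lia.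
have [M'_avoid _] := hP _ (@chord_graph_matching (del_chord (path z))).
(* The matching without this chord still contains [H], although it has a layout with 2 stacks and
   [q] queues. *)
apply: M'_avoid; last by exists H; split=> //; exact: del_chord_contains fz.
apply/mn_chord_graph_le; do 3!eexists; split; last exact: del_obstruction_layout.
by [].
Qed.
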